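(* Let $R$ be a commutative refinement ring and let $f_1,\dots,f_n\in R$ be nonzero elements generating the unit ideal, i.e. $R=(f_1,\dots,f_n)$. Let $M$ and $N$ be finitely generated projective $R$-modules. Then $M\cong N$ if and only if $M_{(f_i)}\cong N_{(f_i)}$ for each $i=1,\dots,n$.
   Context: A ring $R$ is a refinement ring if the monoid $V(R)$ of isomorphism classes of finitely generated projective $R$-modules (under direct sum) has the refinement property: whenever $x_1+x_2=y_1+y_2$ in $V(R)$, there exist $z_{ij}\in V(R)$ with $x_i=z_{i1}+z_{i2}$ and $y_j=z_{1j}+z_{2j}$. For $0\neq x\in R$, let $S=\{1,x,x^2,\dots\}$, $R_{(x)}=S^{-1}R$ and $M_{(x)}=S^{-1}M$. $(f_1,\dots,f_n)$ denotes the ideal generated by $f_1,\dots,f_n$. *)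

(* Defs.v *)
From HB Require Import structures.
From mathcomp Require Import all_boot all_order all_algebra.
Set Implicit Arguments. Unset Strict Implicit. Unset Printing Implicit Defensive.
Import GRing.Theory.
Local Open Scope ring_scope.

Definition fin_gen (R : comNzRingType) (M : lmodType R) : Prop :=
  exists (n : nat) (g : 'I_n -> M),
    forall m : M, exists c : 'I_n -> R, m = \sum_(i < n) c i *: g i.

Definition projective (R : comNzRingType) (M : lmodType R) : Prop :=
  forall (A B : lmodType R) (g : {linear A -> B}) (h : {linear M -> B}),
    (forall b : B, exists a : A, g a = b) ->
    exists h' : {linear M -> A}, forall m : M, g (h' m) = h m.

Definition fg_projective (R : comNzRingType) (M : lmodType R) : Prop :=
  fin_gen M /\ projective M.

Definition mod_iso (R : comNzRingType) (M N : lmodType R) : Prop :=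
  exists f : {linear M -> N}, bijective f.

(* Refinement property of V(R): isomorphism classes of f.g. projective
   modules under direct sum (direct sum = product module). *)
Definition refinement_ring (R : comNzRingType) : Prop :=
  forall X1 X2 Y1 Y2 : lmodType R,
    fg_projective X1 -> fg_projective X2 ->
    fg_projective Y1 -> fg_projective Y2 ->
    mod_iso (X1 * X2)%type (Y1 * Y2)%type ->
    exists Z11 Z12 Z21 Z22 : lmodType R,
      [/\ fg_projective Z11, fg_projective Z12,
          fg_projective Z21, fg_projective Z22 &
      [/\ mod_iso X1 (Z11 * Z12)%type, mod_iso X2 (Z21 * Z22)%type,
          mod_iso Y1 (Z11 * Z21)%type & mod_iso Y2 (Z12 * Z22)%type]].

(* phi : M -> L exhibits L as the localization M_(x) = S^{-1} M,
   S = {1, x, x^2, ...} (characterized as in Mathlib's IsLocalizedModule):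
   x acts bijectively on L, every element of L is phi m / x^k, and
   phi m1 = phi m2 iff x^k m1 = x^k m2 for some k. *)
Definition is_localization (R : comNzRingType) (x : R) (M L : lmodType R)
    (phi : {linear M -> L}) : Prop :=
  [/\ bijective (fun l : L => x *: l),
      (forall l : L, exists (m : M) (k : nat), x ^+ k *: l = phi m) &
      (forall m1 m2 : M, phi m1 = phi m2 ->
         exists k : nat, x ^+ k *: m1 = x ^+ k *: m2)].

(* Main.v *)
Require Import Defs.
From HB Require Import structures.
From mathcomp Require Import all_boot all_order all_algebra.
From mathcomp Require Import boolp zify ring.
Import GRing.Theory.
Local Open Scope ring_scope.
Set Implicit Arguments.
Unset Strict Implicit.
Unset Printing Implicit Defensive.

(** Refining [M + Q = R^n = R + ... + R] writes every finitely generated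
    projective [M] as a direct sum of ideals [e R] with [e] idempotent, since a
    direct summand of [R] has this form.  As [eR + gR] is isomorphic to
    [(e + g - eg)R + egR], the idempotents can be arranged in a decreasing chain
    [e 0 >= e 1 >= ...], where [e k] is the locus of rank [> k].  If [M] and [N]
    have chains [e] and [g] and become isomorphic after inverting [x], comparing
    ranks through a determinant shows that a power of [x] kills
    [e k * (1 - g k)].  When the [f i] generate the unit ideal the two chains
    therefore agree, and a chain determines its module. *)

(** * Isomorphisms, retracts and free modules *)

Definition linear_pack (R : comNzRingType) (U V : lmodType R) (h : U -> V)
    (hlin : linear h) : {linear U -> V} :=
  HB.pack h (GRing.isLinear.Build R U V *:%R h hlin).

Lemma mod_iso_can (R : comNzRingType) (M N : lmodType R) (f : M -> N)
    (g : N -> M) : linear f -> cancel f g -> cancel g f -> mod_iso M N.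
Proof. by move=> flin fK gK; exists (linear_pack flin); exists g. Qed.

Lemma mod_iso_inv (R : comNzRingType) (M N : lmodType R) :
  mod_iso M N ->
  exists (f : {linear M -> N}) (g : {linear N -> M}), cancel f g /\ cancel g f.
Proof.
case=> f [g fK gK]; exists f, (linear_pack (can2_linear fK gK)).
by split.
Qed.

Lemma mod_iso_sym (R : comNzRingType) (M N : lmodType R) :
  mod_iso M N -> mod_iso N M.
Proof. by case/mod_iso_inv=> f [g [fK gK]]; exists g, f. Qed.

Lemma mod_iso_trans (R : comNzRingType) (M N P : lmodType R) :
  mod_iso M N -> mod_iso N P -> mod_iso M P.
Proof.
by case=> f fbij [g gbij]; exists (g \o f); apply: bij_comp.
Qed.

Lemma fg_projective_retract (R : comNzRingType) (P F : lmodType R)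
    (s : {linear P -> F}) (p : {linear F -> P}) :
  cancel s p -> fg_projective F -> fg_projective P.
Proof.
move=> sK [[n [g gP]] Fproj]; split.
  exists n, (fun i => p (g i)) => m.
  have [c cP] := gP (s m); exists c.
  rewrite -[LHS]sK cP linear_sum; apply: eq_bigr => i _.
  by rewrite linearZ.
move=> A B q h qsurj.
have [h' h'P] := Fproj A B q (h \o p) qsurj.
by exists (h' \o s) => m; rewrite /= h'P /= sK.
Qed.

Lemma fg_projective_rV (R : comNzRingType) n : fg_projective 'rV[R]_n.
Proof.
split.
  exists n, (fun i => delta_mx 0 i) => m; exists (fun i => m 0 i).
  exact: row_sum_delta.
move=> A B q h qsurj.
have /fin_all_exists[a aP] (i : 'I_n) := qsurj (h (delta_mx 0 i)).
have lin : linear (fun m : 'rV[R]_n => \sum_i m 0 i *: a i).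
  move=> c x y; rewrite scaler_sumr -big_split; apply: eq_bigr => i _ /=.
  by rewrite !mxE scalerDl scalerA.
exists (linear_pack lin) => m /=.
rewrite [in RHS](row_sum_delta m) !linear_sum; apply: eq_bigr => i _.
by rewrite !linearZ /= aP.
Qed.

(** * Kernels, and complements of projectives in free modules *)

Section Kernel.
Variables (R : comNzRingType) (U V : lmodType R) (p : {linear U -> V}).

Definition ker_pred : {pred U} := [pred x | p x == 0].

Lemma ker_pred_submod_closed : submod_closed ker_pred.
Proof.
split=> [|a x y]; rewrite !inE ?linear0 // => /eqP px /eqP py.
by rewrite linearP px py scaler0 addr0.
Qed.

HB.instance Definition _ :=
  GRing.isSubmodClosed.Build R U ker_pred ker_pred_submod_closed.

Definition linear_ker := {x | ker_pred x}.
HB.instance Definition _ := SubChoice.on linear_ker.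
HB.instance Definition _ := [SubChoice_isSubLmodule of linear_ker by <:].

End Kernel.

Lemma fin_gen_surj (R : comNzRingType) (M : lmodType R) :
  fin_gen M ->
  exists n (p : {linear 'rV[R]_n -> M}), forall m, exists c, p c = m.
Proof.
case=> n [g gP].
have lin : linear (fun c : 'rV[R]_n => \sum_i c 0 i *: g i).
  move=> c x y; rewrite scaler_sumr -big_split; apply: eq_bigr => i _ /=.
  by rewrite !mxE scalerDl scalerA.
exists n, (linear_pack lin) => m.
have [c ->] := gP m; exists (\row_i c i); apply: eq_bigr => i _.
by rewrite mxE.
Qed.

(** Projectivity splits a surjection [p] from a free module by some [s]. The complement is the
    kernel of [p], itself a retract of the free module through [c - s (p c)]. *)
Lemma fg_projective_complement (R : comNzRingType) (M : lmodType R) :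
  fg_projective M ->
  exists n (Q : lmodType R), fg_projective Q /\ mod_iso (M * Q)%type 'rV[R]_n.
Proof.
case=> [/fin_gen_surj[n [p psurj]] Mproj].
have [s sK] := Mproj _ _ p idfun psurj; rewrite /= in sK.
have projQ c : ker_pred p (c - s (p c)).
  by apply/eqP; rewrite linearB /= sK subrr.
pose q c : linear_ker p := Sub (c - s (p c)) (projQ c).
have qlin : linear q.
  move=> a x y; apply: val_inj.
  by rewrite [RHS]linearP /= !linearP /= scalerBr scalerN addrACA.
have valK : cancel (val : linear_ker p -> _) (linear_pack qlin).
  move=> x; apply: val_inj => /=; case: x => x /= /eqP ->.
  by rewrite linear0 subr0.
exists n, (linear_ker p); split.
  exact: fg_projective_retract valK (fg_projective_rV R n).
apply: (@mod_iso_can _ _ _ (fun x => s x.1 + val x.2)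
  (fun c => (p c, linear_pack qlin c))).
- by move=> a x y /=; rewrite !linearP /= scalerDr addrACA.
- case=> m [x /= xP]; move/eqP: (xP) => px.
  have pE : p (s m + x) = m by rewrite linearD /= px sK addr0.
  by congr pair => //; apply: val_inj => /=; rewrite pE addrC addKr.
by move=> c /=; rewrite addrC subrK.
Qed.

(** * Construction of the localization at the powers of one element *)

Section Localization.
Variables (R : comNzRingType) (x : R) (M : lmodType R).

(** The extra power [c] makes the relation transitive even when [x] kills elements of [M]. *)
Definition fraction_eq (p q : M * nat) : bool :=
  `[< exists c, x ^+ (c + q.2) *: p.1 = x ^+ (c + p.2) *: q.1 >].

Lemma fraction_eq_refl : reflexive fraction_eq.
Proof. by move=> p; apply/asboolP; exists 0%N. Qed.

Lemma fraction_eq_sym : symmetric fraction_eq.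
Proof.
by move=> p q; apply/asboolP/asboolP=> -[c cP]; exists c; rewrite cP.
Qed.

Lemma fraction_eq_trans : transitive fraction_eq.
Proof.
move=> [m b] [l a] [n c] /asboolP[i /= iP] /asboolP[j /= jP].
apply/asboolP; exists (i + j + b)%N => /=.
have -> : (i + j + b + c = (j + c) + (i + b))%N by lia.
have -> : (i + j + b + a = (i + a) + (j + b))%N by lia.
rewrite exprD -scalerA iP scalerA -exprD addnC exprD -scalerA jP.
by rewrite scalerA -exprD.
Qed.

Canonical fraction_equiv :=
  EquivRel fraction_eq fraction_eq_refl fraction_eq_sym fraction_eq_trans.

Definition localized := {eq_quot fraction_equiv}%qT.
HB.instance Definition _ := Choice.on localized.

(* [frac m a] is [m / x ^+ a]. *)
Definition frac (m : M) (a : nat) : localized := (\pi_localized (m, a))%qT.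

Lemma fracP m a n b :
  frac m a = frac n b <-> exists c, x ^+ (c + b) *: m = x ^+ (c + a) *: n.
Proof.
by split=> [/eqmodP/asboolP|h] //; apply/eqmodP/asboolP.
Qed.

Lemma frac_ind (P : localized -> Prop) :
  (forall m a, P (frac m a)) -> forall l, P l.
Proof. by move=> H l; rewrite -[l]reprK; case: (repr l). Qed.

Lemma frac_expand k m a : frac (x ^+ k *: m) (k + a) = frac m a.
Proof. by apply/fracP; exists 0%N; rewrite scalerA -exprD addnC. Qed.

Lemma frac_common a b (m n : M) :
  frac m a = frac (x ^+ b *: m) (a + b)
  /\ frac n b = frac (x ^+ a *: n) (a + b).
Proof. by rewrite frac_expand addnC frac_expand. Qed.

Definition loc_add (k l : localized) : localized :=
  let p := repr k in let q := repr l in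
  frac (x ^+ q.2 *: p.1 + x ^+ p.2 *: q.1) (p.2 + q.2).
Definition loc_opp (l : localized) : localized :=
  let p := repr l in frac (- p.1) p.2.
Definition loc_scale (r : R) (l : localized) : localized :=
  let p := repr l in frac (r *: p.1) p.2.

Lemma frac_repr m a :
  exists c, x ^+ (c + (repr (frac m a)).2) *: m =
            x ^+ (c + a) *: (repr (frac m a)).1.
Proof. by apply/fracP; rewrite /frac -surjective_pairing reprK. Qed.

Lemma loc_addE m n a : loc_add (frac m a) (frac n a) = frac (m + n) a.
Proof.
have [c cP] := frac_repr m a; have [d dP] := frac_repr n a.
rewrite /loc_add; move: (repr (frac m a)) (repr (frac n a)) cP dP.
move=> [m' b] [n' b'] /= cP dP.
apply/fracP; exists (c + d)%N; rewrite !scalerDr !scalerA -!exprD.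
have -> : (c + d + a + b' = (d + b') + (c + a))%N by lia.
have -> : (c + d + a + b = (c + b) + (d + a))%N by lia.
have -> : (c + d + (b + b') = (d + b') + (c + b))%N by lia.
rewrite ![x ^+ (_ + _ + _)]exprD -!scalerA -cP -dP !scalerA -!exprD.
by congr (_ + _ *: _); congr (x ^+ _); lia.
Qed.

Lemma loc_scaleE r m a : loc_scale r (frac m a) = frac (r *: m) a.
Proof.
have [c cP] := frac_repr m a.
rewrite /loc_scale; move: (repr _) cP => [m' b] /= cP.
apply/fracP; exists c; rewrite !scalerA ![_ * r]mulrC -!scalerA.
by rewrite cP.
Qed.

Lemma loc_oppE m a : loc_opp (frac m a) = frac (- m) a.
Proof.
have [c cP] := frac_repr m a.
rewrite /loc_opp; move: (repr _) cP => [m' b] /= cP.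
by apply/fracP; exists c; rewrite !scalerN cP.
Qed.

Lemma frac0 a : frac 0 a = frac 0 0.
Proof. by apply/fracP; exists 0%N; rewrite !scaler0. Qed.

(** Passing to a common denominator reduces the module laws to identities between numerators. *)
Lemma frac2_ind (P : localized -> localized -> Prop) :
  (forall m n a, P (frac m a) (frac n a)) -> forall k l, P k l.
Proof.
move=> H; elim/frac_ind=> m a; elim/frac_ind=> n b.
by have [-> ->] := frac_common a b m n.
Qed.

Lemma frac3_ind (P : localized -> localized -> localized -> Prop) :
  (forall m n p a, P (frac m a) (frac n a) (frac p a)) -> forall j k l, P j k l.
Proof.
move=> H; apply: frac2_ind => m n a; elim/frac_ind=> p b.
have [-> ->] := frac_common a b m p.
by have [-> _] := frac_common a b n p.
Qed.

Fact loc_addA : associative loc_add.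
Proof. by apply: frac3_ind => m n p a; rewrite !loc_addE addrA. Qed.
Fact loc_addC : commutative loc_add.
Proof. by apply: frac2_ind => m n a; rewrite !loc_addE addrC. Qed.
Fact loc_add0 : left_id (frac 0 0) loc_add.
Proof. by elim/frac_ind=> m a; rewrite -(frac0 a) loc_addE add0r. Qed.
Fact loc_addN : left_inverse (frac 0 0) loc_opp loc_add.
Proof.
by elim/frac_ind=> m a; rewrite loc_oppE loc_addE addNr frac0.
Qed.

HB.instance Definition _ := GRing.isZmodule.Build localized
  loc_addA loc_addC loc_add0 loc_addN.

Lemma frac_add m n a : frac m a + frac n a = frac (m + n) a.
Proof. exact: loc_addE. Qed.

Fact loc_scaleA r s l : loc_scale r (loc_scale s l) = loc_scale (r * s) l.
Proof. by elim/frac_ind: l => m a; rewrite !loc_scaleE scalerA. Qed.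
Fact loc_scale1 : left_id 1 loc_scale.
Proof. by elim/frac_ind=> m a; rewrite loc_scaleE scale1r. Qed.
Fact loc_scaleDr : right_distributive loc_scale +%R.
Proof.
move=> r; apply: frac2_ind => m n a.
by rewrite frac_add !loc_scaleE frac_add scalerDr.
Qed.
Fact loc_scaleDl l : {morph loc_scale^~ l : r s / r + s}.
Proof.
elim/frac_ind: l => m a r s.
by rewrite !loc_scaleE frac_add scalerDl.
Qed.

HB.instance Definition _ := GRing.Zmodule_isLmodule.Build R localized
  loc_scaleA loc_scale1 loc_scaleDr loc_scaleDl.

Lemma frac_scale r m a : r *: frac m a = frac (r *: m) a.
Proof. exact: loc_scaleE. Qed.

Fact frac_linear : linear (frac^~ 0%N : M -> localized).
Proof. by move=> r m n; rewrite frac_scale frac_add. Qed.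

(** The local hypothesis of the theorem quantifies over all localizations, so it yields information
    only once one is known to exist. *)
Lemma localized_localization :
  is_localization x (linear_pack frac_linear).
Proof.
split.
- have well (l : localized) : exists k : localized, x *: k = l.
    elim/frac_ind: l => m a; exists (frac m a.+1).
    by rewrite frac_scale; apply: (frac_expand 1).
  have [g gP] := choice well; exists g => // l.
  have := gP (x *: l).
  move: (g _) => k; move: k l; apply: frac2_ind => m n a; rewrite !frac_scale.
  move/fracP=> [c]; rewrite !scalerA -!exprSr => cP.
  by apply/fracP; exists c.+1; rewrite !addSn -!addnS !addnS cP.
- apply: frac_ind => m a; exists m, a.
  by rewrite frac_scale /= -[RHS](frac_expand a) addn0.
move=> m n /fracP[c]; rewrite addn0 => cP.
by exists c.
Qed.

End Localization.

(* [M] is the direct sum of the ideals [e i * R], the generator [e i] of the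
   [i]-th one corresponding to [vec i]. *)
Record frame (R : comNzRingType) (M : lmodType R) (e : nat -> R) (n : nat) :=
  Frame {
    vec : nat -> M;
    crd : nat -> {linear M -> R^o};
    frame_sum : forall m, m = \sum_(i < n) (crd i m : R) *: vec i;
    frame_dual : forall i j, crd i (vec j) = e i *+ (i == j);
    frame_chain : forall i, e i * e i.+1 = e i.+1;
    frame_out : forall i, (n <= i)%N -> e i = 0 }.

(** * Modules described by a decreasing chain of idempotents *)

Section FrameTheory.
Variables (R : comNzRingType) (M : lmodType R) (e : nat -> R) (n : nat).
Variable F : frame M e n.

(** Applying [crd F i] to the expansion of [m] leaves only a multiple of [e i], and the same
    computation on [vec F i] shows that [e i] is idempotent. Beyond [n] everything vanishes. *)
Lemma frame_crdE i m : e i * crd F i m = crd F i m.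
Proof.
have crdE : (crd F i m : R) = \sum_(j < n) crd F j m * (e i *+ (i == j)).
  rewrite [in LHS](frame_sum F m) linear_sum; apply: eq_bigr => j _.
  by rewrite linearZ /= frame_dual.
have [ni|lt_in] := leqP n i.
  by rewrite crdE big1 ?mulr0 // => j _; rewrite (frame_out F ni) mul0rn mulr0.
have eE : e i * e i = e i.
  have := congr1 (crd F i) (frame_sum F (vec F i)).
  rewrite frame_dual eqxx linear_sum (bigD1 (Ordinal lt_in)) //= big1.
    by rewrite addr0 linearZ /= !frame_dual eqxx.
  move=> j; rewrite -val_eqE /= => /negPf ji.
  by rewrite frame_dual ji scale0r linear0.
by rewrite crdE mulr_sumr; apply: eq_bigr => j _; rewrite mulrCA mulrnAr eE.
Qed.

Lemma frame_idem i : e i * e i = e i.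
Proof. by have := frame_crdE i (vec F i); rewrite frame_dual eqxx. Qed.

Lemma frame_crd_sum (c : nat -> R) i : (forall j, e j * c j = c j) ->
  crd F i (\sum_(j < n) c j *: vec F j) = c i.
Proof.
move=> cE; rewrite linear_sum.
have termE j : crd F i (c j *: vec F j) = c i *+ (i == j).
  rewrite linearZ /= frame_dual -[c j *: _]/(c j * _) mulrnAr.
  by case: eqP => [<-|//]; rewrite mulrC cE.
under eq_bigr => j _ do rewrite termE.
have [ni|lt_in] := leqP n i.
  by rewrite -cE (frame_out F ni) mul0r big1 // => j _; rewrite mul0rn.
rewrite (bigD1 (Ordinal lt_in)) //= eqxx big1 ?addr0 // => j.
by rewrite -val_eqE /= eq_sym => /negPf ->.
Qed.

Lemma frame_vecE i : e i *: vec F i = vec F i.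
Proof.
rewrite [in RHS](frame_sum F (vec F i)) [in LHS](frame_sum F (vec F i)).
rewrite scaler_sumr; apply: eq_bigr => j _; rewrite scalerA frame_dual.
by case: eqP => [->|]; rewrite ?frame_idem // mulr0.
Qed.

Lemma frame_chain_le i j : (i <= j)%N -> e i * e j = e j.
Proof.
move/subnKC=> <-; elim: (j - i)%N => [|k IHk].
  by rewrite addn0 frame_idem.
by rewrite addnS -(frame_chain F (i + k)) mulrA IHk.
Qed.

Lemma frame_vec_out i : (n <= i)%N -> vec F i = 0.
Proof. by move=> ni; rewrite -frame_vecE (frame_out F ni) scale0r. Qed.

(** Padding by zero summands lets frames of different lengths be compared. *)
Lemma frame_widen p : (n <= p)%N -> frame M e p.
Proof.
move=> np; exists (vec F) (crd F); [|exact: frame_dual|exact: frame_chain F|].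
  move=> m; rewrite {1}(frame_sum F m).
  rewrite (big_ord_widen p (fun i => (crd F i m : R) *: vec F i) np).
  rewrite big_mkcond; apply: eq_bigr => i _ /=.
  by case: ltnP => // /frame_vec_out ->; rewrite scaler0.
by move=> i pi; apply: (frame_out F); apply: leq_trans pi.
Qed.

Lemma frame_iso (N : lmodType R) (f : {linear M -> N}) (g : {linear N -> M}) :
  cancel f g -> cancel g f -> frame N e n.
Proof.
move=> fK gK; exists (fun i => f (vec F i)) (fun i => crd F i \o g).
- move=> m; rewrite -[LHS]gK {1}(frame_sum F (g m)) linear_sum.
  by apply: eq_bigr => i _; rewrite linearZ.
- by move=> i j /=; rewrite fK frame_dual.
- exact: frame_chain F.
exact: frame_out F.
Qed.

(* Adding a summand [g R] to a chain [e 0 >= e 1 >= ...] is done at once, by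
   cutting [g] along the orthogonal idempotents [d i = e (i - 1) - e i]. *)
Definition pred_chain i := if i is k.+1 then e k else 1.
Definition gap i := pred_chain i - e i.

Lemma pred_chain_le i j :
  (i <= j)%N -> pred_chain i * pred_chain j = pred_chain j.
Proof.
case: i j => [|i] [|j] //=; rewrite ?mul1r //.
by rewrite ltnS; apply: frame_chain_le.
Qed.

(** In a decreasing chain a product of two idempotents is the later one, so the four terms of the
    expanded product cancel unless [i = j]. *)
Lemma gap_ortho i j : gap i * gap j = gap i *+ (i == j).
Proof.
have eE k : e k = pred_chain k.+1 by [].
have ppE := pred_chain_le.
wlog: i j / (i <= j)%N => [H|].
  case: (leqP i j) => [/H|/ltnW/H] //.
  by rewrite mulrC eq_sym; case: eqP => // ->.
rewrite leq_eqVlt => /predU1P[->|lt_ij].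
  have le2 := ppE _ _ (leqnSn j); rewrite eqxx mulr1n /gap eE.
  by rewrite mulrBl !mulrBr [X in _ - (X - _)]mulrC le2 !ppE // subrr subr0.
rewrite (ltn_eqF lt_ij) mulr0n /gap !eE mulrBl !mulrBr.
by rewrite !ppE ?subrr //; lia.
Qed.

Lemma gap_mul_chain i : gap i * e i = 0.
Proof.
have /= pE := pred_chain_le (leqnSn i).
by rewrite /gap mulrBl frame_idem pE subrr.
Qed.

Lemma gap_sum : \sum_(i < n.+1) gap i = 1.
Proof.
rewrite -(big_mkord xpredT gap) /=.
rewrite (@telescope_sumr_eq _ _ _ (fun i => - pred_chain i)) //=.
  by rewrite (frame_out F (leqnn n)) oppr0 sub0r opprK.
by move=> i _; rewrite opprK addrC.
Qed.

(** Here [W] is cyclic on [w], and [psi w] is idempotent because [psi w *: w = w]. Where [gap i] is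
    1, [M] has rank exactly [i], so slot [i] is free there and receives that piece of [W]. *)
Lemma frame_insert (W : lmodType R) (w : W) (psi : {linear W -> R^o}) :
  (forall z, (psi z : R) *: w = z) ->
  frame (M * W)%type (fun i => e i + gap i * (psi w : R)) n.+1.
Proof.
move=> psiE.
have crdlin i : linear (fun x : M * W => crd F i x.1 + gap i * psi x.2 : R^o).
  move=> a x y /=; rewrite !linearP /= mulrDr scalerDr addrACA.
  by congr (_ + _ + _); apply: mulrCA.
exists (fun i => (vec F i, gap i *: w)) (fun i => linear_pack (crdlin i)) => /=.
- move=> [m z]; rewrite (surjective_pairing (\sum_(i < _) _)).
  have -> (r : 'I_n.+1 -> M * W) : (\sum_i r i).1 = \sum_i (r i).1.
    exact: (big_morph fst).
  have -> (r : 'I_n.+1 -> M * W) : (\sum_i r i).2 = \sum_i (r i).2.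
    exact: (big_morph snd).
  congr pair => /=.
    (* The new slot [n] adds nothing to the first component as [vec F n = 0]; the [psi] terms die by
       [gap i * e i = 0]. *)
    rewrite {1}(frame_sum F m) big_ord_recr /= frame_vec_out // scaler0 addr0.
    apply: eq_bigr => i _; rewrite -[in RHS]frame_vecE scalerA mulrDl.
    by rewrite mulrAC gap_mul_chain mul0r addr0 mulrC frame_crdE.
  rewrite -[in LHS](scale1r z) -gap_sum scaler_suml; apply: eq_bigr => i _.
  rewrite -frame_crdE scalerA mulrDl mulrC mulrA gap_mul_chain mul0r add0r.
  by rewrite mulrAC gap_ortho eqxx -scalerA psiE.
- move=> i j; rewrite frame_dual linearZ /= -[gap j *: _]/(gap j * _).
  rewrite mulrA gap_ortho; case: eqP => // _.
  by rewrite !mulr0n mul0r addr0.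
- move=> i; rewrite mulrDl !mulrDr (frame_chain F).
  have pE : pred_chain i * e i.+1 = e i.+1.
    by have /= := pred_chain_le (leqW (leqnSn i)).
  have -> : gap i * psi w * e i.+1 = 0.
    by rewrite mulrAC /gap mulrBl (frame_chain F) pE subrr mul0r.
  have -> : gap i * psi w * (gap i.+1 * psi w) = 0.
    by rewrite mulrACA gap_ortho ltn_eqF // mul0r.
  rewrite !addr0 mulrA; congr (_ + _ * _).
  by rewrite /gap /= mulrBr frame_idem (frame_chain F).
move=> [|i] //; rewrite ltnS => ni.
by rewrite /gap /= !(frame_out F) ?subrr ?mul0r ?addr0 //; lia.
Qed.

End FrameTheory.

(** In both modules the coordinate families are exactly the [c] with [e j * c j = c j], so
    transporting coordinates is an isomorphism. *)
Lemma frame_unique (R : comNzRingType) (M N : lmodType R) (e : nat -> R) n :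
  frame M e n -> frame N e n -> mod_iso M N.
Proof.
move=> F G; pose f m := \sum_(i < n) (crd F i m : R) *: vec G i.
pose g m := \sum_(i < n) (crd G i m : R) *: vec F i.
have flin : linear f.
  move=> a x y; rewrite scaler_sumr -big_split; apply: eq_bigr => i _ /=.
  by rewrite linearP scalerDl scalerA.
have fE i m : crd G i (f m) = crd F i m.
  by apply: (frame_crd_sum G (c := fun i => crd F i m)) => j; apply: frame_crdE.
have gE i m : crd F i (g m) = crd G i m.
  apply: (frame_crd_sum F (c := fun i => crd G i m)) => j.
  exact: frame_crdE.
apply: (mod_iso_can flin (g := g)) => m.
  by rewrite [RHS](frame_sum F); apply: eq_bigr => i _; rewrite fE.
by rewrite [RHS](frame_sum G); apply: eq_bigr => i _; rewrite gE.
Qed.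

(** * Existence of chains over a refinement ring *)

Lemma mod_iso_rV_split (R : comNzRingType) p q :
  mod_iso 'rV[R]_(p + q) ('rV[R]_p * 'rV[R]_q)%type.
Proof.
apply: (@mod_iso_can R 'rV[R]_(p + q) ('rV[R]_p * 'rV[R]_q)%type
  (fun x => (lsubmx x, rsubmx x)) (fun x => row_mx x.1 x.2)).
- by move=> a x y; rewrite !linearP.
- by move=> x; rewrite /= hsubmxK.
by move=> [x y]; rewrite /= row_mxKl row_mxKr.
Qed.

Lemma frame_exists (R : comNzRingType) n (M Q : lmodType R) :
  refinement_ring R -> fg_projective M -> fg_projective Q ->
  mod_iso (M * Q)%type 'rV[R]_n -> exists e, inhabited (frame M e n).
Proof.
move=> Rref; elim: n M Q => [|n IHn] M Q Mproj Qproj.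
  move=> /mod_iso_inv[f [g [fK _]]].
  have M0 m : m = 0 :> M.
    have : f (m, 0) = f (0, 0) by apply/rowP=> -[].
    by move/(can_inj fK)=> [].
  exists (fun=> 0); constructor; exists (fun=> 0) (fun=> \0%R) => //=.
  - by move=> m; rewrite big_ord0 [m]M0.
  - by move=> i j; rewrite mul0rn.
  by move=> i; rewrite mul0r.
have splitE := mod_iso_rV_split R n 1; rewrite addn1 in splitE.
move=> /mod_iso_trans/(_ splitE) MQ.
(* Refining [M + Q = R^n + R] gives [M = Z11 + Z12]. Induction applies to [Z11], a summand of [R^n],
   and [Z12], a summand of [R], is then inserted. *)
have [Z11 [Z12 [Z21 [Z22 [P11 P12 P21 P22 isos]]]]] :=
  Rref _ _ _ _ Mproj Qproj (fg_projective_rV R n) (fg_projective_rV R 1) MQ.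
case: isos => /mod_iso_sym/mod_iso_inv[f [g [fK gK]]] _ /mod_iso_sym nE.
case/mod_iso_inv=> h [k [hK kK]].
have [e [F]] := IHn _ _ P11 P21 nE.
have psilin : linear (fun z : Z12 => k (z, 0) 0 0 : R^o).
  move=> a x y; have -> : (a *: x + y, 0) = a *: (x, 0) + (y, 0) :> Z12 * Z22.
    by congr pair; rewrite /= scaler0 addr0.
  by rewrite linearP !mxE.
(* [Z12] is generated by the projection of the unit of [R], with coefficient the image of [z] in
   [R]. *)
have psiE z : k (z, 0) 0 0 *: (h (const_mx 1)).1 = z.
  rewrite -[RHS]/((z, 0) : Z12 * Z22).1 -[in RHS](kK (z, 0)).
  have {2}-> : k (z, 0) = k (z, 0) 0 0 *: const_mx 1.
    by apply/rowP=> i; rewrite !mxE !ord1 mulr1.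
  by rewrite linearZ.
have G := frame_insert F (psi := linear_pack psilin) psiE.
by eexists; constructor; apply: frame_iso G _ _ _ fK gK.
Qed.

(** * Functoriality of localization and clearing of denominators *)

Section LocalizationTheory.
Variables (R : comNzRingType) (x : R).

Lemma localization_exp_bij (M L : lmodType R) (phi : {linear M -> L}) k :
  is_localization x phi -> bijective (fun l : L => x ^+ k *: l).
Proof.
case=> xbij _ _; elim: k => [|k IHk].
  by exists id => l; rewrite expr0 scale1r.
by apply: (eq_bij (bij_comp xbij IHk)) => l; rewrite /= scalerA exprS.
Qed.

(** The map is built as a graph: [T l l'] says that one power of [x] clears both denominators and
    that [f] matches the numerators. The graph is single-valued because powers of [x] act
    injectively on [LN]. *)
Lemma localization_map (M N LM LN : lmodType R) (phiM : {linear M -> LM})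
    (phiN : {linear N -> LN}) (f : {linear M -> N}) :
  is_localization x phiM -> is_localization x phiN ->
  exists F : {linear LM -> LN}, forall m, F (phiM m) = phiN (f m).
Proof.
move=> locM locN; have [_ surjM eqM] := locM.
have xinj k : injective (fun l : LN => x ^+ k *: l).
  exact: bij_inj (localization_exp_bij k locN).
pose T l l' := exists m k, x ^+ k *: l = phiM m /\ x ^+ k *: l' = phiN (f m).
have Tfun l l1 l2 : T l l1 -> T l l2 -> l1 = l2.
  move=> [m1 [k1 [m1E n1E]]] [m2 [k2 [m2E n2E]]].
  have /eqM[c cE] : phiM (x ^+ k2 *: m1) = phiM (x ^+ k1 *: m2).
    by rewrite !linearZ /= -m1E -m2E !scalerA -!exprD addnC.
  have E1 : x ^+ (c + (k1 + k2)) *: l1 = phiN (f (x ^+ c *: (x ^+ k2 *: m1))).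
    by rewrite !linearZ /= -n1E !scalerA -!exprD; congr (x ^+ _ *: _); lia.
  have E2 : x ^+ (c + (k1 + k2)) *: l2 = phiN (f (x ^+ c *: (x ^+ k1 *: m2))).
    by rewrite !linearZ /= -n2E !scalerA -!exprD; congr (x ^+ _ *: _); lia.
  by apply: (xinj (c + (k1 + k2))%N); rewrite E1 cE E2.
have Texist l : exists l', T l l'.
  have [m [k mE]] := surjM l.
  have [h _ hK] := localization_exp_bij k locN.
  by exists (h (phiN (f m))), m, k; split=> //; apply: hK.
have [F FT] := choice Texist.
have Flin : linear F.
  move=> a l1 l2; apply: (Tfun (a *: l1 + l2)) => //.
  have [m1 [k1 [m1E n1E]]] := FT l1; have [m2 [k2 [m2E n2E]]] := FT l2.
  exists (x ^+ k2 *: (a *: m1) + x ^+ k1 *: m2), (k1 + k2)%N.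
  have xE (V : lmodType R) (u w : V) : x ^+ (k1 + k2) *: (a *: u + w) =
      x ^+ k2 *: (a *: (x ^+ k1 *: u)) + x ^+ k1 *: (x ^+ k2 *: w).
    by rewrite scalerDr !scalerA exprD; congr (_ *: _ + _); ring.
  have linE (V W : lmodType R) (h : {linear V -> W}) u w :
      h (x ^+ k2 *: (a *: u) + x ^+ k1 *: w) =
      x ^+ k2 *: (a *: h u) + x ^+ k1 *: h w.
    by rewrite [LHS]linearD ![h (_ *: _)]linearZ.
  by rewrite !xE m1E n1E m2E n2E !linE.
exists (linear_pack Flin) => m; apply: Tfun (FT (phiM m)) _.
by exists m, 0%N; rewrite expr0 !scale1r.
Qed.

Lemma localization_map_comp_id (M N LM LN : lmodType R)
    (phiM : {linear M -> LM}) (f : {linear M -> N}) (g : {linear N -> M})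
    (phiN : {linear N -> LN}) (F : {linear LM -> LN}) (G : {linear LN -> LM}) :
  is_localization x phiM -> cancel f g ->
  (forall m, F (phiM m) = phiN (f m)) -> (forall n, G (phiN n) = phiM (g n)) ->
  cancel F G.
Proof.
move=> locM fK FE GE l; have [_ surjM _] := locM.
have [m [k mE]] := surjM l.
apply: (bij_inj (localization_exp_bij k locM)).
by rewrite /= -!linearZ mE FE GE fK.
Qed.

Lemma localization_iso (M N LM LN : lmodType R) (phiM : {linear M -> LM})
    (phiN : {linear N -> LN}) :
  is_localization x phiM -> is_localization x phiN ->
  mod_iso M N -> mod_iso LM LN.
Proof.
move=> locM locN /mod_iso_inv[f [g [fK gK]]].
have [F FE] := localization_map f locM locN.
have [G GE] := localization_map g locN locM.
exists F; exists G.
  exact: localization_map_comp_id locM fK FE GE.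
exact: localization_map_comp_id locN gK GE FE.
Qed.

Lemma exists_common_exp n (P : 'I_n -> nat -> Prop) :
  (forall i a b, P i a -> P i (b + a)%N) -> (forall i, exists a, P i a) ->
  exists a, forall i, P i a.
Proof.
move=> Pmono /fin_all_exists[a aP]; exists (\sum_i a i)%N => i.
by rewrite (bigD1 i) //= addnC; apply: Pmono.
Qed.

(* Clearing denominators in an isomorphism of localizations and its inverse. *)
Lemma localized_iso_factor (M N LM LN : lmodType R) (phiM : {linear M -> LM})
    (phiN : {linear N -> LN}) (g : nat -> R) n (G : frame N g n) :
  is_localization x phiM -> is_localization x phiN -> mod_iso LM LN ->
  exists m : 'I_n -> M, forall v, exists k y,
    x ^+ k *: v = \sum_(j < n) (crd G j y : R) *: m j.
Proof.
move=> locM locN /mod_iso_inv[F [H [FK HK]]].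
have [_ surjM eqM] := locM; have [_ surjN _] := locN.
(* One exponent [b] clears the denominators of the images of all [vec G j] under the inverse
   isomorphism. *)
have [b /fin_all_exists[m mE]] : exists b, forall j : 'I_n,
    exists m, x ^+ b *: H (phiN (vec G j)) = phiM m.
  apply: exists_common_exp => [j a b [m mE]|j].
    by exists (x ^+ b *: m); rewrite exprD -scalerA mE linearZ.
  by have [m [a mE]] := surjM (H (phiN (vec G j))); exists a, m.
exists m => v; have [y [a yE]] := surjN (F (phiM v)).
have /eqM[c cE] : phiM (x ^+ (b + a) *: v) =
    phiM (\sum_(j < n) (crd G j y : R) *: m j).
  have vE : x ^+ a *: phiM v = H (phiN y) by rewrite -yE linearZ /= FK.
  rewrite linearZ /= exprD -scalerA vE.
  rewrite {1}(frame_sum G y) !linear_sum; apply: eq_bigr => j _.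
  by rewrite !linearZ /= mE.
exists (c + (b + a))%N, (x ^+ c *: y).
rewrite exprD -scalerA cE scaler_sumr; apply: eq_bigr => j _.
by rewrite scalerA [in RHS]linearZ.
Qed.

End LocalizationTheory.

(** * Comparison of ranks and patching over the unit ideal *)

Lemma det_mulmx_thin (R : comNzRingType) k (A B : 'M[R]_k.+1) :
  (forall i, A i ord_max = 0) -> \det (A *m B) = 0.
Proof.
move=> A0; rewrite det_mulmx (expand_det_col A ord_max) big1 ?mul0r //.
by move=> i _; rewrite A0 mul0r.
Qed.

(** The elements with some power killing [u] form the radical of the annihilator of [u]; this ideal
    contains every [f i], hence 1. *)
Lemma unit_ideal_annihilator (R : comNzRingType) n (f c : 'I_n -> R) u :
  \sum_(i < n) c i * f i = 1 -> (forall i, exists k, f i ^+ k * u = 0) -> u = 0.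
Proof.
move=> cf1 fu; pose K x := exists k, x ^+ k * u = 0.
suff [k] : K 1 by rewrite expr1n mul1r.
rewrite -cf1; elim/big_rec: _ => [|i x _ [l lE]].
  by exists 1%N; rewrite mul0r.
have [k kE] := fu i; exists (k + l)%N.
(* Each binomial term contains either [x ^+ l] or [f i ^+ k], since the exponents add up to
   [k + l]. *)
rewrite exprDn mulr_suml big1 // => j _; rewrite mulrnAl exprMn.
have [le_lj|lt_jl] := leqP l j.
  by rewrite -(subnK le_lj) [x ^+ _]exprD -!mulrA lE !mulr0 mul0rn.
have -> : (k + l - j = (l - j) + k)%N by lia.
rewrite [f i ^+ _]exprD; set p := c i ^+ _; set q := x ^+ _.
have -> : p * (f i ^+ (l - j) * f i ^+ k) * q * u =
    p * f i ^+ (l - j) * q * (f i ^+ k * u) by ring.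
by rewrite kE mulr0 mul0rn.
Qed.


(* With [u = e k * (1 - g k)], the first [k + 1] summands of [u M] are free over
   [u R] while [u N] only needs [k] generators. *)
Lemma localized_iso_rank (R : comNzRingType) (x : R) (M N LM LN : lmodType R)
    (phiM : {linear M -> LM}) (phiN : {linear N -> LN})
    (e g : nat -> R) n p k :
  frame M e n -> frame N g p ->
  is_localization x phiM -> is_localization x phiN -> mod_iso LM LN ->
  exists D, x ^+ D * (e k * (1 - g k)) = 0.
Proof.
move=> F G0 locM locN LMN.
(* Length at least [k + 1] gives [B] its [k + 1] rows, even when [p <= k]. *)
pose G := frame_widen G0 (leq_maxr k.+1 p).
have le_kp : (k < maxn k.+1 p)%N by exact: leq_maxl.
move: (maxn _ _) G le_kp => q G lt_kq.
have [m mP] := localized_iso_factor G locM locN LMN.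
have /fin_all_exists[D /fin_all_exists[y yE]] (i : 'I_k.+1) := mP (vec F i).
set u := e k * (1 - g k).
have uu : u * u = u.
  have -> : u * u = (e k * e k) * (1 - g k - g k + g k * g k).
    by rewrite /u; ring.
  by rewrite (frame_idem F) (frame_idem G) subrK.
have ue i : (i <= k)%N -> u * e i = u.
  by move=> ik; rewrite mulrAC [_ * e i]mulrC (frame_chain_le F ik).
have ug j : (k <= j)%N -> u * g j = 0.
  move=> kj; rewrite -(frame_chain_le G kj) /u.
  have -> : e k * (1 - g k) * (g k * g j) = e k * (g k - g k * g k) * g j.
    by ring.
  by rewrite (frame_idem G) subrr mulr0 mul0r.
(* [A] holds the coordinates of [y i] in [N], cut down by [u]. Column [k] may be set to zero because
   [u * g k = 0], and this makes the determinant of [A *m B] vanish. *)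
pose A : 'M[R]_k.+1 := \matrix_(i, j)
  if (j < k)%N then u * (crd G j (y i) : R) else 0.
pose B : 'M[R]_k.+1 := \matrix_(j, i) crd F i (m (widen_ord lt_kq j)).
have AB : A *m B = diag_mx (\row_i (u * x ^+ D i)).
  apply/matrixP=> i l; rewrite !mxE.
  transitivity (u * (crd F l (\sum_(j < q) (crd G j (y i) : R) *: m j) : R)).
    rewrite [in RHS]linear_sum [RHS]mulr_sumr.
    rewrite (bigID (fun j : 'I_q => j < k.+1)%N) /=.
    rewrite [X in _ + X]big1 ?addr0 => [|j]; last first.
      rewrite -leqNgt => /ltnW kj; rewrite linearZ /= mulrA.
      by rewrite -(frame_crdE G) mulrA ug // !mul0r.
    rewrite (big_ord_narrow lt_kq); apply: eq_bigr => j _; rewrite !mxE.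
    rewrite linearZ /= mulrA; case: ltnP => // kj.
    by rewrite -(frame_crdE G) mulrA ug // !mul0r.
  rewrite -yE linearZ /= frame_dual (val_eqE l i) eq_sym.
  rewrite -[x ^+ _ *: _]/(x ^+ D i * _).
  case: eqP => [->|_]; last by rewrite !mulr0n !mulr0.
  by rewrite !mulr1n mulrCA ue ?(leq_ord l) // mulrC.
have prod0 : \prod_(i < k.+1) (u * x ^+ D i) = 0.
  rewrite -(det_mulmx_thin B (A := A)) => [|i]; last by rewrite mxE ltnn.
  by rewrite AB det_diag; apply: eq_bigr => i _; rewrite mxE.
have uX i : u ^+ i.+1 = u by elim: i => // i IHi; rewrite exprS IHi.
(* The vanishing determinant is [u ^+ k.+1] times a power of [x], and [u] is idempotent. *)
exists (\sum_i D i)%N; rewrite mulrC -prod0 big_split /= prodrXr prodr_const.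
by rewrite card_ord uX.
Qed.

(** For each [i], a power of [f i] kills [e k * (1 - g k)], so this element is zero. *)
Lemma local_iso_chain_le (R : comNzRingType) n (f c : 'I_n -> R)
    (M N : lmodType R) (e g : nat -> R) p q k :
  frame M e p -> frame N g q -> \sum_(i < n) c i * f i = 1 ->
  (forall i (LM LN : lmodType R) (phiM : {linear M -> LM})
     (phiN : {linear N -> LN}),
     is_localization (f i) phiM -> is_localization (f i) phiN ->
     mod_iso LM LN) ->
  e k * g k = e k.
Proof.
move=> F G cf1 MN; apply/eqP; rewrite -subr_eq0 -opprB oppr_eq0.
rewrite -{1}[e k]mulr1 -mulrBr; apply/eqP.
apply: unit_ideal_annihilator cf1 _ => i.
have locM := localized_localization (f i) M.
have locN := localized_localization (f i) N.
exact: localized_iso_rank F G locM locN (MN _ _ _ _ _ locM locN).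
Qed.

Theorem theorem2p6 (R : comNzRingType) (n : nat) (f : 'I_n -> R)
    (M N : lmodType R) :
  refinement_ring R ->
  (forall i, f i != 0) ->
  (exists c : 'I_n -> R, \sum_(i < n) c i * f i = 1) ->
  fg_projective M -> fg_projective N ->
  (mod_iso M N <->
   forall i : 'I_n,
   forall (LM LN : lmodType R) (phiM : {linear M -> LM}) (phiN : {linear N -> LN}),
     is_localization (f i) phiM -> is_localization (f i) phiN ->
     mod_iso LM LN).
Proof.
move=> Rref _ [c cf1] Mproj Nproj; split=> [MN i LM LN phiM phiN locM locN|MN].
  exact: localization_iso locM locN MN.
have [p [Q [Qproj MQ]]] := fg_projective_complement Mproj.
have [q [Q' [Q'proj NQ]]] := fg_projective_complement Nproj.
have [e [F]] := frame_exists Rref Mproj Qproj MQ.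
have [g [G]] := frame_exists Rref Nproj Q'proj NQ.
have eg : e = g.
  (* The comparison is used in both directions: [e k = e k * g k = g k]. *)
  apply/funext => k; rewrite -(local_iso_chain_le k F G cf1 MN) mulrC.
  apply: (local_iso_chain_le k G F cf1) => i LN LM phiN phiM locN locM.
  exact: mod_iso_sym (MN i _ _ _ _ locM locN).
rewrite eg in F.
exact: frame_unique (frame_widen F (leq_maxl p q))
  (frame_widen G (leq_maxr p q)).
Qed.
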